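(* (1) Let $\mathbf{C}$ be $\mathbf{VL}_{\mathrm{IP}}$ or $\mathbf{NL}_{\mathrm{IP}}$, let $\bigl((E_i)_{i\in I},(\varphi_{ji})_{j\geq i}\bigr)$ be a direct system in $\mathbf{C}$, and suppose that $\bigl(E,(\varphi_i)_{i\in I}\bigr)$ is a direct limit of the system in that same category $\mathbf{C}$. Then $E=\bigcup_i\varphi_i(E_i)$, $\varphi_i(E_i)\subseteq\varphi_j(E_j)$ whenever $i\leq j$, and the $\varphi_i(E_i)$ are ideals in $E$. (2) Let $\mathbf{C}$ be $\mathbf{NL}_{\mathrm{AIP}}$ or $\mathbf{BL}_{\mathrm{AIP}}$, let $\bigl((E_i)_{i\in I},(\varphi_{ji})_{j\geq i}\bigr)$ be a direct system in $\mathbf{C}$, and suppose that $\bigl(E,(\varphi_i)_{i\in I}\bigr)$ is a direct limit of the system in that category $\mathbf{C}$. Then $E=\overline{\bigcup_i\varphi_i(E_i)}$, $\varphi_i(E_i)\subseteq\varphi_j(E_j)$ whenever $i\leq j$, and the closures $\overline{\varphi_i(E_i)}$ are ideals in $E$.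
   Context: All vector spaces are real. Vector lattices need not be Archimedean. A normed lattice is a normed vector lattice. A contraction is a linear map of norm at most $1$. A linear map $\varphi\colon E\to F$ between vector lattices is interval preserving if it is positive and $\varphi([0,x])=[0,\varphi(x)]$ for all $x\in E^+$; a linear map $\varphi\colon E\to F$ from a vector lattice into a normed lattice is almost interval preserving if it is positive and $[0,\varphi(x)]=\overline{\varphi([0,x])}$ (norm closure in $F$) for all $x\in E^+$. Categories: $\mathbf{VL}_{\mathrm{IP}}$: vector lattices and interval preserving linear maps. $\mathbf{NL}_{\mathrm{IP}}$: normed lattices and interval preserving contractions. $\mathbf{NL}_{\mathrm{AIP}}$: normed lattices and almost interval preserving contractions. $\mathbf{BL}_{\mathrm{AIP}}$: Banach lattices and almost interval preserving contractions. Direct systems and limits in a category: let $I$ be a non-empty directed set. A direct system over $I$ consists of objects $O_i$ ($i\in I$) and morphisms $\varphi_{ji}\colon O_i\to O_j$ for $j\geq i$ such that $\varphi_{ii}$ is the identity and $\varphi_{kj}\circ\varphi_{ji}=\varphi_{ki}$ for $i\leq j\leq k$. A system $(O,(\varphi_i))$ of an object $O$ and morphisms $\varphi_i\colon O_i\to O$ is compatible if $\varphi_j\circ\varphi_{ji}=\varphi_i$ for all $j\geq i$. A direct limit is a compatible system $(O,(\varphi_i))$ such that, for every compatible system $(O',(\varphi_i'))$, there is a unique morphism $\chi\colon O\to O'$ with $\varphi_i'=\chi\circ\varphi_i$ for all $i$. *)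

(* Defs.v *)
From HB Require Import structures.
From mathcomp Require Import all_boot all_order all_algebra.
From mathcomp Require Import all_classical reals topology normedtype.

Set Implicit Arguments.
Unset Strict Implicit.
Unset Printing Implicit Defensive.

Import Order.TTheory GRing.Theory Num.Theory.
Import numFieldNormedType.Exports.

Local Open Scope classical_set_scope.
Local Open Scope ring_scope.

(* The join of Order.Lattice and GRing.Lmodule cannot be declared as an HB
   structure, since Num.RealDomain already inherits from ordered and additive
   structures without such a join below it.  The order and the lattice
   operations are therefore fields of the mixin, and the Order.Lattice
   structure is then put on the carriers by the instances below. *)
HB.mixin Record isVectorLattice (R : realType) V of GRing.Lmodule R V := {
  vle : rel V ;
  vmeet : V -> V -> V ;
  vjoin : V -> V -> V ;
  vle_refl : reflexive vle ;
  vle_anti : antisymmetric vle ;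
  vle_trans : transitive vle ;
  vmeetP : forall x y z, vle x (vmeet y z) = vle x y && vle x z ;
  vjoinP : forall x y z, vle (vjoin x y) z = vle x z && vle y z ;
  vleD2r : forall z x y : V, vle x y -> vle (x + z) (y + z) ;
  vleZ2l : forall (a : R) (x y : V), 0 <= a -> vle x y -> vle (a *: x) (a *: y)
}.

#[short(type="vectorLatticeType")]
HB.structure Definition VectorLattice (R : realType) :=
  {V of isVectorLattice R V & GRing.Lmodule R V}.

Section VectorLatticeOrder.
Variables (R : realType) (V : vectorLatticeType R).
#[non_forgetful_inheritance]
HB.instance Definition _ := Order.Le_isPOrder.Build ring_display
  (VectorLattice.sort V) (@vle_refl R V) (@vle_anti R V) (@vle_trans R V).
#[non_forgetful_inheritance]
HB.instance Definition _ := Order.POrder_MeetJoin_isLattice.Build ring_display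
  (VectorLattice.sort V) (@vmeetP R V) (@vjoinP R V).
End VectorLatticeOrder.

(* The lattice modulus of x; `|x| is reserved for the norm. *)
Definition modulus (R : realType) (V : vectorLatticeType R) (x : V) : V :=
  Order.join x (- x).

HB.mixin Record isNormedLattice (R : realType) V
    of VectorLattice R V & NormedModule R V := {
  ler_modulus_norm :
    forall x y : V, vle (modulus x) (modulus y) -> `|x| <= `|y|
}.

#[short(type="normedLatticeType")]
HB.structure Definition NormedLattice (R : realType) :=
  {V of isNormedLattice R V & VectorLattice R V & NormedModule R V}.

#[short(type="banachLatticeType")]
HB.structure Definition BanachLattice (R : realType) :=
  {V of NormedLattice R V & CompleteNormedModule R V}.

#[non_forgetful_inheritance]
HB.instance Definition _ (R : realType) (V : normedLatticeType R) :=
  Order.Lattice.copy (NormedLattice.sort V) (VectorLattice.sort V).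
#[non_forgetful_inheritance]
HB.instance Definition _ (R : realType) (V : banachLatticeType R) :=
  Order.Lattice.copy (BanachLattice.sort V) (VectorLattice.sort V).

Section Maps.
Context {R : realType}.

Definition positive (E F : vectorLatticeType R) (f : E -> F) : Prop :=
  forall x : E, 0 <= x -> 0 <= f x.

Definition interval_preserving (E F : vectorLatticeType R) (f : E -> F) : Prop :=
  [/\ linear f, positive f &
      forall x : E, 0 <= x -> f @` `[0, x]%classic = `[0, f x]%classic].

Definition almost_interval_preserving (E : vectorLatticeType R)
    (F : normedLatticeType R) (f : E -> F) : Prop :=
  [/\ linear f, positive f &
      forall x : E, 0 <= x -> `[0, f x]%classic = closure (f @` `[0, x]%classic)].

Definition contraction (E F : normedLatticeType R) (f : E -> F) : Prop :=
  linear f /\ forall x : E, `|f x| <= `|x|.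

Definition ideal (E : vectorLatticeType R) (A : set E) : Prop :=
  [/\ A 0, forall (a : R) (x y : E), A x -> A y -> A (a *: x + y) &
      forall x y : E, modulus x <= modulus y -> A y -> A x].

End Maps.

(* Categories whose morphisms are the maps between carriers singled out by
   [hom], with the usual identity and composition of maps. *)
Record concrete_category := ConcreteCategory {
  obj :> Type ;
  carrier : obj -> Type ;
  hom : forall A B : obj, (carrier A -> carrier B) -> Prop ;
  hom_id : forall A, @hom A A id ;
  hom_comp : forall A B C (f : carrier A -> carrier B) (g : carrier B -> carrier C),
    hom f -> hom g -> hom (g \o f)
}.
Arguments hom {c A B} f.
Coercion carrier : obj >-> Sortclass.

Section DirectLimits.
Context {C : concrete_category} {d : Order.disp_t} {I : preorderType d}.

Record direct_system := DirectSystem {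
  sys_obj :> I -> C ;
  sys_map : forall i j, (i <= j)%O -> sys_obj i -> sys_obj j ;
  sys_map_hom : forall i j (ij : (i <= j)%O), hom (sys_map ij) ;
  sys_map_id : forall i (ii : (i <= i)%O), sys_map ii = id ;
  sys_map_comp : forall i j k (ij : (i <= j)%O) (jk : (j <= k)%O) (ik : (i <= k)%O),
    sys_map jk \o sys_map ij = sys_map ik
}.

Definition compatible (S : direct_system) (A : C) (phi : forall i, S i -> A) : Prop :=
  (forall i, hom (phi i)) /\
  forall i j (ij : (i <= j)%O), phi j \o sys_map ij = phi i.

Definition direct_limit (S : direct_system) (A : C) (phi : forall i, S i -> A) : Prop :=
  compatible phi /\
  forall (A' : C) (phi' : forall i, S i -> A'), compatible phi' ->
    exists! chi : A -> A', hom chi /\ forall i, phi' i = chi \o phi i.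

End DirectLimits.
Arguments direct_system C {d} I.
Arguments direct_limit {C d I} S A phi.

(* A directed set is a preorder, not necessarily antisymmetric. *)
Definition directed d (I : preorderType d) : Prop :=
  forall i j : I, exists k : I, (i <= k)%O /\ (j <= k)%O.

Section Laws.
Context {R : realType}.

Lemma linear_comp (E F G : lmodType R) (f : E -> F) (g : F -> G) :
  linear f -> linear g -> linear (g \o f).
Proof. by move=> lf lg a x y /=; rewrite lf lg. Qed.

Lemma interval_preserving_id (E : vectorLatticeType R) :
  interval_preserving (@id E).
Proof. by split=> // x x0; rewrite image_id. Qed.

Lemma interval_preserving_comp (E F G : vectorLatticeType R)
    (f : E -> F) (g : F -> G) :
  interval_preserving f -> interval_preserving g -> interval_preserving (g \o f).
Proof.
move=> [lf pf If] [lg pg Ig]; split.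
- exact: linear_comp.
- by move=> x /pf/pg.
- by move=> x x0; rewrite -image_comp If// Ig//; exact: pf.
Qed.

Lemma contraction_id (E : normedLatticeType R) : contraction (@id E).
Proof. by []. Qed.

Lemma contraction_comp (E F G : normedLatticeType R) (f : E -> F) (g : F -> G) :
  contraction f -> contraction g -> contraction (g \o f).
Proof.
move=> [lf nf] [lg ng]; split; first exact: linear_comp.
by move=> x; exact: le_trans (ng _) (nf _).
Qed.

Lemma vl_leD2r (E : vectorLatticeType R) (z x y : E) : x <= y -> x + z <= y + z.
Proof. exact: vleD2r. Qed.

Lemma vl_leZ2l (E : vectorLatticeType R) (a : R) (x y : E) :
  0 <= a -> x <= y -> a *: x <= a *: y.
Proof. exact: vleZ2l. Qed.

Lemma ler_norm_modulus (E : normedLatticeType R) (x y : E) :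
  modulus x <= modulus y -> `|x| <= `|y|.
Proof. exact: ler_modulus_norm. Qed.

Lemma modulus_ge0 (E : vectorLatticeType R) (x : E) : 0 <= modulus x.
Proof.
set v := modulus x.
have xv : x <= v by exact: leUl.
have nxv : - x <= v by exact: leUr.
have v2 : 0 <= v + v.
  have := vl_leD2r (- x) xv; rewrite subrr => /le_trans; apply.
  by rewrite addrC; exact: vl_leD2r.
have := @vl_leZ2l E 2^-1 0 (v + v).
rewrite invr_ge0 ler0n scaler0 => /(_ isT v2).
by rewrite -mulr2n -(scaler_nat 2 v) scalerA mulVf ?pnatr_eq0// scale1r.
Qed.

Lemma ge0_modulus (E : vectorLatticeType R) (x : E) : 0 <= x -> modulus x = x.
Proof.
move=> x0; apply: join_l; apply: (le_trans _ x0).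
by have := vl_leD2r (- x) x0; rewrite add0r subrr.
Qed.

Lemma closed_ge0 (E : normedLatticeType R) : closed [set x : E | 0 <= x].
Proof.
move=> y cy; set n := Order.join (- y) 0.
have n0 : 0 <= n by exact: leUr.
suff /eqP : `|n| == 0.
  move=> /normr0_eq0 nE.
  have ny : - y <= 0 by rewrite -nE; exact: leUl.
  by have := vl_leD2r y ny; rewrite addNr add0r.
rewrite eq_le normr_ge0 andbT; apply/ler_addgt0Pr => e e0; rewrite add0r.
have [p [/= p0 yp]] := cy _ (nbhsx_ballx y e e0).
rewrite -ball_normE /= in yp; apply: le_trans (ltW yp).
apply: ler_norm_modulus; rewrite (ge0_modulus n0) leUx modulus_ge0 andbT.
apply: (@le_trans _ _ (- (y - p))); last exact: leUr.
by have := vl_leD2r (- y) p0; rewrite add0r opprB.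
Qed.

Lemma closed_itv0 (E : normedLatticeType R) (x : E) : closed `[0, x]%classic.
Proof.
move=> y cy; rewrite /= in_itv /=; apply/andP; split.
  by apply: closed_ge0 => B /cy [z [/=]]; rewrite in_itv /= => /andP[z0 _] Bz; exists z.
suff : 0 <= x - y by move=> /(vl_leD2r y); rewrite add0r subrK.
apply: closed_ge0 => B /nbhs_ballP[e e0 eB].
have [z [/=]] := cy _ (nbhsx_ballx y e e0).
rewrite in_itv /= -ball_normE /= => /andP[_ zx] yz; exists (x - z); split.
  by have := vl_leD2r (- z) zx; rewrite subrr.
by apply: eB; rewrite -ball_normE /= opprB addrC addrA subrK distrC.
Qed.

Lemma contraction_closure (E F : normedLatticeType R) (f : E -> F) (A : set E) :
  contraction f -> f @` closure A `<=` closure (f @` A).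
Proof.
move=> [lf nf] _ [y cy <-] B /nbhs_ballP[e e0 eB].
have [z [Az]] := cy _ (nbhsx_ballx y e e0); rewrite -ball_normE /= => yz.
exists (f z); split; first by exists z.
apply: eB; rewrite -ball_normE /=; apply: le_lt_trans yz.
suff -> : f y - f z = f (y - z) by [].
by rewrite [y - z]addrC -[- z]scaleN1r lf scaleN1r addrC.
Qed.

Lemma almost_interval_preserving_id (E : normedLatticeType R) :
  almost_interval_preserving (@id E).
Proof.
split=> // x x0; rewrite image_id; apply/seteqP; split.
  exact: subset_closure.
exact: closed_itv0.
Qed.

Lemma almost_interval_preserving_comp (E F G : normedLatticeType R)
    (f : E -> F) (g : F -> G) : contraction g ->
  almost_interval_preserving f -> almost_interval_preserving g ->
  almost_interval_preserving (g \o f).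
Proof.
move=> cg [lf pf If] [lg pg Ig]; split.
- exact: linear_comp.
- by move=> x /pf/pg.
move=> x x0; rewrite Ig ?pf// If// -[in RHS]image_comp; apply/seteqP; split.
  move=> y cy; apply: closed_closure; move: y cy; apply: closureS.
  exact: contraction_closure.
by apply: closureS; apply: image_subset; exact: subset_closure.
Qed.

Lemma ip_contraction_comp (E F G : normedLatticeType R) (f : E -> F) (g : F -> G) :
  interval_preserving f /\ contraction f ->
  interval_preserving g /\ contraction g ->
  interval_preserving (g \o f) /\ contraction (g \o f).
Proof.
move=> [If Cf] [Ig Cg].
by split; [exact: interval_preserving_comp | exact: contraction_comp].
Qed.

Lemma aip_contraction_comp (E F G : normedLatticeType R) (f : E -> F) (g : F -> G) :
  almost_interval_preserving f /\ contraction f ->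
  almost_interval_preserving g /\ contraction g ->
  almost_interval_preserving (g \o f) /\ contraction (g \o f).
Proof.
move=> [If Cf] [Ig Cg].
by split; [exact: almost_interval_preserving_comp | exact: contraction_comp].
Qed.

End Laws.

Section Categories.
Variable R : realType.

Definition VL_IP : concrete_category :=
  @ConcreteCategory (vectorLatticeType R) (fun E => E)
    (fun E F f => interval_preserving f)
    (fun E => interval_preserving_id E)
    (fun E F G f g => @interval_preserving_comp R E F G f g).

Definition NL_IP : concrete_category :=
  @ConcreteCategory (normedLatticeType R) (fun E => E)
    (fun E F f => interval_preserving f /\ contraction f)
    (fun E => conj (interval_preserving_id E) (contraction_id E))
    (fun E F G f g => @ip_contraction_comp R E F G f g).

Definition NL_AIP : concrete_category :=
  @ConcreteCategory (normedLatticeType R) (fun E => E)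
    (fun E F f => almost_interval_preserving f /\ contraction f)
    (fun E => conj (almost_interval_preserving_id E) (contraction_id E))
    (fun E F G f g => @aip_contraction_comp R E F G f g).

Definition BL_AIP : concrete_category :=
  @ConcreteCategory (banachLatticeType R) (fun E => E)
    (fun E F f => almost_interval_preserving f /\ contraction f)
    (fun E => conj (almost_interval_preserving_id E) (contraction_id E))
    (fun E F G f g => @aip_contraction_comp R E F G f g).

End Categories.

(* Main.v *)
(** Whatever an element of the range of an (almost) interval preserving map
    dominates lies in (the closure of) that range, so the (closed) range is an
    ideal, and so is the (closed) directed union [A] of the ranges of the
    [phi i].  An ideal [A], closed in the Banach case, is itself an object of
    the category, the maps [phi i] corestrict to it, and its inclusion
    [iota] into [E] is interval preserving.  The universal property yields
    [chi : E -> A] with [iota \o chi] and [id] both mediating from the limit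
    to itself; hence [iota \o chi = id] and [A = E]. *)

Require Import Defs.
From HB Require Import structures.
From mathcomp Require Import all_boot all_order all_algebra.
From mathcomp Require Import all_classical reals topology normedtype.

Import Order.TTheory GRing.Theory Num.Theory.
Import numFieldNormedType.Exports.

Local Open Scope classical_set_scope.
Local Open Scope ring_scope.

(** * Order arithmetic in a vector lattice *)

Section VectorLatticeTheory.
Context {R : realType} {E : vectorLatticeType R}.
Implicit Types x y z : E.

Lemma vl_leD x y z t : x <= y -> z <= t -> x + z <= y + t.
Proof.
move=> xy zt; apply: (le_trans (vl_leD2r _ xy)).
by rewrite ![y + _]addrC; exact: vl_leD2r.
Qed.

Lemma vl_leN x y : x <= y -> - y <= - x.
Proof.
by move=> /(vl_leD2r (- x - y)); rewrite addrA subrr add0r addrC subrK.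
Qed.

Lemma vl_subr_ge0 x y : x <= y -> 0 <= y - x.
Proof. by move=> /(vl_leD2r (- x)); rewrite subrr. Qed.

(** Translation by [z] is monotone, and so is its inverse, translation by [- z]; each gives one of
    the two inequalities. *)
Lemma vl_joinDr x y z : Order.join x y + z = Order.join (x + z) (y + z).
Proof.
apply/le_anti/andP; split; last by rewrite leUx !vl_leD2r ?leUl ?leUr.
rewrite -[leRHS](subrK z) vl_leD2r// leUx.
by rewrite -{1}(addrK z x) -{2}(addrK z y) !vl_leD2r ?leUl ?leUr.
Qed.

Lemma le_modulus x : x <= modulus x.
Proof. exact: leUl. Qed.

Lemma leN_modulus x : - x <= modulus x.
Proof. exact: leUr. Qed.

Lemma modulus_modulus x : modulus (modulus x) = modulus x.
Proof. exact: ge0_modulus (modulus_ge0 x). Qed.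

Lemma modulusD x y : modulus (x + y) <= modulus x + modulus y.
Proof.
by rewrite leUx opprD !vl_leD ?le_modulus ?leN_modulus.
Qed.

Lemma modulusB_modulus x y : modulus x - modulus y <= modulus (x - y).
Proof.
rewrite -[leRHS](addrK (modulus y)); apply: vl_leD2r.
by rewrite -{1}(subrK y x) modulusD.
Qed.

Lemma posB_neg x : Order.join x 0 - Order.join (- x) 0 = x.
Proof.
have -> : Order.join x 0 = Order.join (- x) 0 + x.
  by rewrite vl_joinDr addNr add0r joinC.
by rewrite addrC addKr.
Qed.

Lemma itv0P x y : `[0, x]%classic y <-> 0 <= y /\ y <= x.
Proof. by rewrite /= in_itv /=; split=> /andP. Qed.

End VectorLatticeTheory.

(** * Subspaces, ideals, and ideals as sublattices *)

Definition subspace {R : realType} {E : lmodType R} (A : set E) :=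
  A 0 /\ forall (a : R) (x y : E), A x -> A y -> A (a *: x + y).

Section Ideals.
Context {R : realType} {E : vectorLatticeType R}.
Implicit Types A : set E.

Lemma subspaceB A x y : subspace A -> A x -> A y -> A (x - y).
Proof. by move=> [_ lA] Ax Ay; rewrite addrC -scaleN1r; exact: lA. Qed.

(** The positive and negative parts of [x] both lie between [0] and [modulus x], so solidity can be
    tested on positive elements, the only ones that intervals [[0, f x]] contain. *)
Lemma subspace_ideal A : subspace A ->
    (forall z y, 0 <= z -> z <= modulus y -> A y -> A z) ->
  ideal A.
Proof.
move=> [A0 lA] sA; split=> // x y xy Ay.
rewrite -(posB_neg x); apply: subspaceB => //; apply: (sA _ y) => //;
  rewrite ?leUr//; apply: le_trans xy;
  by rewrite leUx modulus_ge0 ?le_modulus ?leN_modulus.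
Qed.

Lemma idealD A x y : ideal A -> A x -> A y -> A (x + y).
Proof. by move=> [_ lA _] Ax Ay; rewrite -(scale1r x); exact: lA. Qed.

Lemma ideal_modulus A x : ideal A -> A x -> A (modulus x).
Proof. by move=> [_ _ sA]; apply: sA; rewrite modulus_modulus. Qed.

(** Serves to show that ideals are sublattices, since join and meet obey these bounds. The bounds
    say that [modulus z] is at most [modulus x + modulus y], a positive element of [A]. *)
Lemma ideal_between A x y z : ideal A -> A x -> A y ->
  - (modulus x + modulus y) <= z -> z <= modulus x + modulus y -> A z.
Proof.
move=> iA Ax Ay lz zu.
have [_ _ sA] := iA; apply: (sA _ (modulus x + modulus y)); last first.
  by apply: idealD => //; exact: ideal_modulus.
rewrite [leRHS]ge0_modulus ?leUx ?zu /=.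
  by rewrite -[leRHS]opprK vl_leN.
by rewrite -(addr0 0) vl_leD// modulus_ge0.
Qed.

Let le_modulusDl (x y : E) : x <= modulus x + modulus y.
Proof. by rewrite -{1}(addr0 x) vl_leD ?le_modulus ?modulus_ge0. Qed.

Let leN_modulusDl (x y : E) : - (modulus x + modulus y) <= x.
Proof.
rewrite -[leRHS]opprK vl_leN// -(addr0 (- x)).
by rewrite vl_leD ?leN_modulus ?modulus_ge0.
Qed.

Lemma ideal_join A x y : ideal A -> A x -> A y -> A (Order.join x y).
Proof.
move=> iA Ax Ay; apply: (ideal_between A x y) => //.
  exact: le_trans (leN_modulusDl x y) (leUl _ _).
by rewrite leUx le_modulusDl addrC le_modulusDl.
Qed.

Lemma ideal_meet A x y : ideal A -> A x -> A y -> A (Order.meet x y).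
Proof.
move=> iA Ax Ay; apply: (ideal_between A x y) => //.
  by rewrite lexI leN_modulusDl addrC leN_modulusDl.
exact: le_trans (leIl _ _) (le_modulusDl x y).
Qed.

End Ideals.

(** * An ideal as a vector lattice *)

Section IdealSub.
Context {R : realType} {E : vectorLatticeType R} {A : set E}.

(** The proof [iA] is an argument so that the submodule instance, which depends on it, can be
    inferred from the predicate. *)
Definition ideal_pred (iA : ideal A) : {pred E} := fun x => x \in A.

Variable iA : ideal A.

Lemma ideal_predE x : (x \in ideal_pred iA) = (x \in A).
Proof. by []. Qed.

Lemma ideal_submod_closed : submod_closed (ideal_pred iA).
Proof.
have [A0 lA _] := iA; split; first by rewrite ideal_predE inE.
by move=> a x y; rewrite !ideal_predE !inE; exact: lA.
Qed.

HB.instance Definition _ :=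
  GRing.isSubmodClosed.Build R E (ideal_pred iA) ideal_submod_closed.

Definition ideal_sub := {x : E | x \in ideal_pred iA}.

HB.instance Definition _ := SubChoice.on ideal_sub.
HB.instance Definition _ := [SubChoice_isSubLmodule of ideal_sub by <:].

Implicit Types x y z : ideal_sub.

Lemma ideal_subP x : A (\val x).
Proof. by have := valP x; rewrite ideal_predE inE. Qed.

Definition to_ideal_sub (x : E) (Ax : A x) : ideal_sub :=
  exist _ x (mem_set Ax).

(** Everything is computed in [E], so the laws of meet and join, and later the comparison of moduli,
    hold by conversion. *)
Definition sub_le x y := vle (\val x) (\val y).
Definition sub_meet x y :=
  to_ideal_sub _ (ideal_meet A _ _ iA (ideal_subP x) (ideal_subP y)).
Definition sub_join x y :=
  to_ideal_sub _ (ideal_join A _ _ iA (ideal_subP x) (ideal_subP y)).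

Lemma sub_le_refl : reflexive sub_le.
Proof. by move=> x; exact: vle_refl. Qed.

Lemma sub_le_anti : antisymmetric sub_le.
Proof. by move=> x y /vle_anti/val_inj. Qed.

Lemma sub_le_trans : transitive sub_le.
Proof. by move=> y x z; exact: vle_trans. Qed.

Lemma sub_meetP x y z : sub_le x (sub_meet y z) = sub_le x y && sub_le x z.
Proof. exact: vmeetP. Qed.

Lemma sub_joinP x y z : sub_le (sub_join x y) z = sub_le x z && sub_le y z.
Proof. exact: vjoinP. Qed.

Lemma sub_leD2r z x y : sub_le x y -> sub_le (x + z) (y + z).
Proof. exact: vleD2r. Qed.

Lemma sub_leZ2l (a : R) x y : 0 <= a -> sub_le x y -> sub_le (a *: x) (a *: y).
Proof. exact: vleZ2l. Qed.

HB.instance Definition _ := isVectorLattice.Build R ideal_sub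
  sub_le_refl sub_le_anti sub_le_trans sub_meetP sub_joinP sub_leD2r sub_leZ2l.

End IdealSub.

(** * Restriction of the norm to an ideal *)

Section NormedIdealSub.
Context {R : realType} {E : normedLatticeType R} {A : set E} (iA : ideal A).

Local Notation T := (ideal_sub iA).
Implicit Types x y : T.

Definition sub_norm x : R := `|\val x : E|.

Lemma sub_normD x y : sub_norm (x + y) <= sub_norm x + sub_norm y.
Proof. exact: ler_normD. Qed.

Lemma sub_normZ (a : R) x : sub_norm (a *: x) = `|a| * sub_norm x.
Proof. exact: normrZ. Qed.

Lemma sub_norm0_eq0 x : sub_norm x = 0 -> x = 0.
Proof. by move=> /normr0_eq0 /= x0; exact: val_inj. Qed.

HB.instance Definition _ := @Lmodule_isNormed.Build R T
  sub_norm sub_normD sub_normZ sub_norm0_eq0.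

Lemma sub_norm_modulus x y : vle (modulus x) (modulus y) -> `|x| <= `|y|.
Proof. exact: (@ler_modulus_norm R E (\val x) (\val y)). Qed.

HB.instance Definition _ := isNormedLattice.Build R T sub_norm_modulus.

End NormedIdealSub.

(** * Inclusion of an ideal and corestriction to it *)

Section Inclusion.
Context {R : realType} {E F : vectorLatticeType R} {A : set E} (iA : ideal A).

Definition ideal_incl (x : ideal_sub iA) : E := \val x.

(** By solidity the whole interval [[0, x]] of [E] lies in [A] once [x] does. *)
Lemma ideal_incl_ip : interval_preserving ideal_incl.
Proof.
split=> // x x0; apply/seteqP; split=> [_ [y + <-]//|y].
move=> /itv0P[y0 yx].
have Ay : A y.
  have [_ _ sA] := iA; apply: sA (ideal_subP iA x).
  by rewrite !ge0_modulus// (le_trans y0).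
by exists (to_ideal_sub iA y Ay) => //; apply/itv0P.
Qed.

Variables (f : F -> E) (fA : range f `<=` A).

Definition corestrict (x : F) : ideal_sub iA :=
  to_ideal_sub iA (f x) (fA _ (imageT f x)).

Lemma corestrict_linear : linear f -> linear corestrict.
Proof. by move=> lf a x y; apply: val_inj; exact: lf. Qed.

(** Intervals of the ideal are traces of intervals of [E] and the inclusion is injective, so the
    equality of sets can be checked in [E]. *)
Lemma corestrict_ip : interval_preserving f -> interval_preserving corestrict.
Proof.
move=> [lf pf If]; split=> [|x /pf//|x x0]; first exact: corestrict_linear.
apply/seteqP; split=> [_ [y yx <-]|u ux].
  have : (f @` `[0, x]%classic) (f y) by exists y.
  by rewrite If.
have : `[0, f x]%classic (ideal_incl u) by [].
by rewrite -If// => -[y yx fyu]; exists y => //; exact: val_inj.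
Qed.

End Inclusion.

(** * Norm closures of subspaces and ideals *)

Section NormedTheory.
Context {R : realType} {E : normedLatticeType R}.
Implicit Types (A : set E) (x y z : E).

Lemma closure_normP A x :
  closure A x <-> forall e : R, 0 < e -> exists2 y, A y & `|x - y| < e.
Proof.
split=> [cA e e0|h B /nbhs_ballP[e e0 eB]].
  have [y [Ay]] := cA _ (nbhsx_ballx x e e0).
  by rewrite -ball_normE; exists y.
have [y Ay xy] := h e e0; exists y; split=> //.
by apply: eB; rewrite -ball_normE.
Qed.

Lemma closure_subspace A : subspace A -> subspace (closure A).
Proof.
move=> [A0 lA]; split; first exact: subset_closure.
move=> a x y /closure_normP cx /closure_normP cy; apply/closure_normP => e e0.
(* The summand [1] keeps the divisor positive when [a = 0]. *)
have a0 : 0 < `|a| + 1 by rewrite ltr_wpDl.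
have e20 : 0 < e / 2 by rewrite divr_gt0.
have [x' Ax' xx'] := cx (e / 2 / (`|a| + 1)) (divr_gt0 e20 a0).
have [y' Ay' yy'] := cy (e / 2) e20.
exists (a *: x' + y'); first exact: lA.
rewrite opprD addrACA -scalerBr (le_lt_trans (ler_normD _ _))//.
rewrite [e]splitr ler_ltD// normrZ.
rewrite (@le_trans _ _ ((`|a| + 1) * `|x - x'|))//.
  by rewrite ler_wpM2r// lerDl.
by rewrite mulrC -ler_pdivlMr// ltW.
Qed.

(** The hypothesis asks for [closure A z] only, which is all that the range of an almost interval
    preserving map provides. For [y] in the closure, approximate [y] by [y'] in [A] and truncate [z]
    at [modulus y']. *)
Lemma closure_ideal A : subspace A ->
    (forall z y, 0 <= z -> z <= modulus y -> A y -> closure A z) ->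
  ideal (closure A).
Proof.
move=> sA clA; apply: subspace_ideal; first exact: closure_subspace.
move=> z y z0 zy /closure_normP cy.
(* The truncations of [z] are known to lie in [closure A] only, so the goal becomes membership in
   the closure of [closure A]. *)
rewrite [closure A](closure_id _).1; last exact: closed_closure.
apply/closure_normP => e e0; have [y' Ay' yy'] := cy e e0.
(* [z - z /\ |y'| <= |y - y'|] because [0 <= z <= |y|] *)
exists (Order.meet z (modulus y')).
  by apply: (clA _ y') => //; rewrite ?leIr// lexI z0 modulus_ge0.
apply: le_lt_trans yy'; apply: ler_norm_modulus.
rewrite ge0_modulus; last by rewrite vl_subr_ge0// leIl.
have zm : z - modulus (y - y') <= Order.meet z (modulus y').
  rewrite lexI; apply/andP; split.
    have := vl_leD z z _ _ (lexx z) (vl_leN _ _ (modulus_ge0 (y - y'))).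
    by rewrite oppr0 addr0.
  have := vl_leD _ _ _ _ zy (vl_leN _ _ (modulusB_modulus y y')).
  by rewrite opprB [leRHS]addrC subrK.
have := vl_leD2r (modulus (y - y') - Order.meet z (modulus y')) zm.
by rewrite addrA subrK addrCA subrr addr0.
Qed.

End NormedTheory.

(** * Norm properties of the inclusion and the corestriction *)

Section NormedInclusion.
(* Qualified, as [normedtype] has its own [contraction] (of Lipschitz maps). *)
Context {R : realType} {E F : normedLatticeType R} {A : set E} (iA : ideal A).

Lemma ideal_incl_contraction :
  Defs.contraction (ideal_incl iA : ideal_sub iA -> E).
Proof. by []. Qed.

(** Order intervals are norm closed, so taking the closure of the image adds nothing. *)
Lemma ip_aip (f : F -> E) :
  interval_preserving f -> almost_interval_preserving f.
Proof.
move=> [lf pf If]; split=> // x x0; rewrite If//; apply/closure_id.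
exact: closed_itv0.
Qed.

(** The inclusion is isometric, so approximations inside the ideal and inside [E] are the same. *)
Lemma closure_ideal_incl (B : set (ideal_sub iA)) (u : ideal_sub iA) :
  closure B u <-> closure (ideal_incl iA @` B) (ideal_incl iA u).
Proof.
split=> /closure_normP h; apply/closure_normP => e /h.
  by move=> [v Bv uv]; exists (ideal_incl iA v) => //; exists v.
by move=> [_ [v Bv <-] uv]; exists v.
Qed.

Variables (f : F -> E) (fA : range f `<=` A).

Lemma corestrict_contraction :
  Defs.contraction f -> Defs.contraction (corestrict iA f fA).
Proof. by move=> [lf nf]; split=> //; exact: corestrict_linear. Qed.

Lemma corestrict_aip : almost_interval_preserving f ->
  almost_interval_preserving (corestrict iA f fA).
Proof.
move=> [lf pf If]; split=> [|x /pf//|x x0]; first exact: corestrict_linear.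
apply/predeqP => u; rewrite closure_ideal_incl image_comp -[_ \o _]/f -If//.
Qed.

End NormedInclusion.

(** * Completeness of closed ideals *)

Section ClosedIdealComplete.
Context {R : realType} {E : banachLatticeType R} {A : set E} (iA : ideal A).

(** A Cauchy filter on the ideal is pushed forward to [E] and converges there; closedness keeps the
    limit in [A], and the isometric inclusion reflects the convergence. *)
Lemma ideal_sub_complete : closed A ->
  forall G : set_system (ideal_sub iA), ProperFilter G -> cauchy G -> cvg G.
Proof.
move=> cA G PG /cauchy_ballP cG.
have cE : cauchy (ideal_incl iA @ G).
  apply/cauchy_ballP => e e0.
  have [[P Q] /= [GP GQ] PQ] := cG e e0.
  exists (ideal_incl iA @` P, ideal_incl iA @` Q) => /=.
    split; [apply: filterS GP|apply: filterS GQ] => u Pu; exists u => //.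
  move=> [_ _] /= [[u Pu <-] [v Qv <-]].
  by have := PQ (u, v) (conj Pu Qv); rewrite -!ball_normE.
have /cvg_ex[/= y Gy] : cvg (ideal_incl iA @ G) by exact: cauchy_cvg.
have Ay : A y.
  apply: (closed_cvg A cA _ _ Gy).
  exact: (@filterE _ G _ _ (ideal_subP iA)).
apply/cvg_ex; exists (to_ideal_sub iA y Ay) => B /nbhs_ballP[e e0 eB].
apply: (@filterS _ G _ (ideal_incl iA @^-1` ball y e) B _
  (Gy _ (nbhsx_ballx y e e0))).
move=> u yu.
by apply: eB; rewrite -ball_normE /=; rewrite -ball_normE /= in yu.
Qed.

End ClosedIdealComplete.

(** Stated for an arbitrary concrete category so that one argument covers all four cases. Since
    [chi] is a right inverse of [iota] on carriers, [chi a] is a preimage of [a]. *)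
Lemma direct_limit_surjective (C : concrete_category) (d : Order.disp_t)
    (I : preorderType d) (S : direct_system C I) (A U : C)
    (phi : forall i, S i -> A) (psi : forall i, S i -> U) (iota : U -> A) :
  direct_limit S A phi -> Defs.hom iota -> compatible psi ->
  (forall i, iota \o psi i = phi i) -> range iota = setT.
Proof.
move=> [cphi uphi] hi cpsi ip; apply/seteqP; split=> // a _.
have [chi [[hchi chiE] _]] := uphi U psi cpsi.
have [rho [_ uniq]] := uphi A phi cphi.
have ic : iota \o chi = id.
  transitivity rho; last by apply/uniq; split=> //; exact: Defs.hom_id.
  apply/esym/uniq; split; first exact: Defs.hom_comp.
  by move=> i; rewrite -compA -chiE ip.
by exists (chi a) => //; rewrite -[RHS]/(id a) -ic.
Qed.

(** * Ranges of (almost) interval preserving maps *)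

Section PositiveMaps.
Context {R : realType}.

Lemma range_subspace {E F : lmodType R} (f : E -> F) :
  linear f -> subspace (range f).
Proof.
move=> lf; split=> [|a _ _ [x _ <-] [y _ <-]].
  (* Linearity with scalar [-1] at zero vectors gives the value [- f 0 + f 0] at this witness. *)
  by exists (- 0 + 0) => //; rewrite -scaleN1r lf scaleN1r addNr.
by exists (a *: x + y); rewrite ?lf.
Qed.

(** A positive linear map is monotone, and both [x] and [- x] lie below [modulus x]. *)
Lemma le_modulus_image {E F : vectorLatticeType R} (f : E -> F) x :
  linear f -> positive f -> modulus (f x) <= f (modulus x).
Proof.
move=> lf pf; have fB u v : v <= u -> f v <= f u.
  move=> /vl_subr_ge0/pf; rewrite addrC -scaleN1r lf scaleN1r.
  by move=> /(vl_leD2r (f v)); rewrite add0r addrAC addNr add0r.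
rewrite leUx fB ?le_modulus//=.
suff <- : f (- x) = - f x by rewrite fB ?leN_modulus.
have f0 : f 0 = 0 by have := lf (-1) 0 0; rewrite scaler0 addr0 scaleN1r addNr.
by have := lf (-1) x 0; rewrite f0 !addr0 !scaleN1r.
Qed.

(** If [y = f x], then [z] lies in [[0, f (modulus x)]], which is the image of [[0, modulus x]]. *)
Lemma ip_range_solid {E F : vectorLatticeType R} (f : E -> F) z y :
  interval_preserving f -> 0 <= z -> z <= modulus y -> range f y -> range f z.
Proof.
move=> [lf pf If] z0 zy [x _ xy].
have : `[0, f (modulus x)]%classic z.
  apply/itv0P; split=> //; apply: (le_trans zy); rewrite -xy.
  exact: le_modulus_image.
by rewrite -If ?modulus_ge0// => -[u _ <-]; exists u.
Qed.

Lemma aip_range_solid {E F : normedLatticeType R} (f : E -> F) z y :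
  almost_interval_preserving f -> 0 <= z -> z <= modulus y -> range f y ->
  closure (range f) z.
Proof.
move=> [lf pf If] z0 zy [x _ xy].
have : `[0, f (modulus x)]%classic z.
  apply/itv0P; split=> //; apply: (le_trans zy); rewrite -xy.
  exact: le_modulus_image.
by rewrite If ?modulus_ge0//; apply: closureS; exact: image_subset.
Qed.

Lemma ip_range_ideal {E F : vectorLatticeType R} (f : E -> F) :
  interval_preserving f -> ideal (range f).
Proof.
move=> If; apply: subspace_ideal => [|z y]; last exact: ip_range_solid.
by apply: range_subspace; case: If.
Qed.

Lemma aip_closure_range_ideal {E F : normedLatticeType R} (f : E -> F) :
  almost_interval_preserving f -> ideal (closure (range f)).
Proof.
move=> If; apply: closure_ideal => [|z y]; last exact: aip_range_solid.
by apply: range_subspace; case: If.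
Qed.

End PositiveMaps.

(** * Directed unions of ranges *)

Section DirectedUnion.
Context {R : realType} {d : Order.disp_t} {I : preorderType d}.
Hypotheses (I0 : inhabited I) (dI : directed I).

Lemma compatible_range (C : concrete_category) (S : direct_system C I) (A : C)
    (phi : forall i, S i -> A) (i j : I) :
  compatible phi -> (i <= j)%O -> range (phi i) `<=` range (phi j).
Proof.
move=> [_ cphi] ij _ [x _ <-]; exists (sys_map ij x) => //.
by rewrite -(cphi i j ij).
Qed.

(** Directedness brings two elements into a common [B k]; non-emptiness of [I] supplies zero. *)
Lemma directed_bigcup_subspace (E : vectorLatticeType R) (B : I -> set E) :
  (forall i j, (i <= j)%O -> B i `<=` B j) -> (forall i, subspace (B i)) ->
  subspace (\bigcup_i B i).
Proof.
move=> mB sB; split; first by case: I0 => i; exists i => //; case: (sB i).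
move=> a x y [i _ Bx] [j _ By]; have [k [ik jk]] := dI i j.
by exists k => //; case: (sB k) => _; apply; [exact: mB Bx|exact: mB By].
Qed.

Lemma directed_bigcup_ip_ideal (F : I -> vectorLatticeType R)
    (E : vectorLatticeType R) (phi : forall i, F i -> E) :
  (forall i j, (i <= j)%O -> range (phi i) `<=` range (phi j)) ->
  (forall i, interval_preserving (phi i)) -> ideal (\bigcup_i range (phi i)).
Proof.
move=> mphi Iphi; apply: subspace_ideal => [|z y z0 zy [i _ iy]].
  apply: directed_bigcup_subspace => // i; apply: range_subspace.
  by case: (Iphi i).
by exists i => //; exact: ip_range_solid zy iy.
Qed.

(** Solidity is applied within the one range containing [y]; the closure of that range is contained
    in the closure of the union. *)
Lemma directed_bigcup_aip_ideal (F : I -> normedLatticeType R)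
    (E : normedLatticeType R) (phi : forall i, F i -> E) :
  (forall i j, (i <= j)%O -> range (phi i) `<=` range (phi j)) ->
  (forall i, almost_interval_preserving (phi i)) ->
  ideal (closure (\bigcup_i range (phi i))).
Proof.
move=> mphi Iphi; apply: closure_ideal => [|z y z0 zy [i _ iy]].
  apply: directed_bigcup_subspace => // i; apply: range_subspace.
  by case: (Iphi i).
have sub : range (phi i) `<=` \bigcup_i range (phi i) by move=> u; exists i.
exact: closureS sub _ (aip_range_solid _ _ _ (Iphi i) z0 zy iy).
Qed.

End DirectedUnion.

(** * Surjectivity of the inclusion in the four categories *)

Lemma range_ideal_incl (R : realType) (E : vectorLatticeType R) (A : set E)
  (iA : ideal A) : range (ideal_incl iA) = setT -> [set: E] = A.
Proof.
move=> rT; apply/esym/seteqP; split=> // x.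
by rewrite -rT => -[u _ <-]; exact: (ideal_subP iA u).
Qed.

Theorem proposition5p1 (R : realType) (d : Order.disp_t) (I : preorderType d)
    (I_nonempty : inhabited I) (I_directed : directed I) :
  [/\ (forall (S : direct_system (VL_IP R) I) (E : vectorLatticeType R)
          (phi : forall i : I, S i -> E),
        direct_limit S (E : VL_IP R) phi ->
        [/\ [set: E] = \bigcup_(i in [set: I]) range (phi i),
            forall i j : I, (i <= j)%O -> range (phi i) `<=` range (phi j) &
            forall i : I, ideal (range (phi i))]),
      (forall (S : direct_system (NL_IP R) I) (E : normedLatticeType R)
          (phi : forall i : I, S i -> E),
        direct_limit S (E : NL_IP R) phi ->
        [/\ [set: E] = \bigcup_(i in [set: I]) range (phi i),
            forall i j : I, (i <= j)%O -> range (phi i) `<=` range (phi j) &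
            forall i : I, ideal (range (phi i))]),
      (forall (S : direct_system (NL_AIP R) I) (E : normedLatticeType R)
          (phi : forall i : I, S i -> E),
        direct_limit S (E : NL_AIP R) phi ->
        [/\ [set: E] = closure (\bigcup_(i in [set: I]) range (phi i)),
            forall i j : I, (i <= j)%O -> range (phi i) `<=` range (phi j) &
            forall i : I, ideal (closure (range (phi i)))]) &
      (forall (S : direct_system (BL_AIP R) I) (E : banachLatticeType R)
          (phi : forall i : I, S i -> E),
        direct_limit S (E : BL_AIP R) phi ->
        [/\ [set: E] = closure (\bigcup_(i in [set: I]) range (phi i)),
            forall i j : I, (i <= j)%O -> range (phi i) `<=` range (phi j) &
            forall i : I, ideal (closure (range (phi i)))])].
Proof.
split=> S E phi lim; have [[hphi cphi] _] := lim;
  have mphi (i j : I) : (i <= j)%O -> range (phi i) `<=` range (phi j)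
    by (exact: (compatible_range _ _ _ phi _ _ lim.1)).
- split=> // [|i]; last exact: ip_range_ideal (hphi i).
  have iA := directed_bigcup_ip_ideal I_nonempty I_directed _ _ _ mphi hphi.
  apply: (range_ideal_incl _ _ _ iA).
  have fA i : range (phi i) `<=` \bigcup_i range (phi i) by move=> u; exists i.
  pose U : vectorLatticeType R := ideal_sub iA.
  apply: (direct_limit_surjective _ _ _ _ _ (U : VL_IP R) _
    (fun i => corestrict iA (phi i) (fA i)) (ideal_incl iA) lim).
  + exact: ideal_incl_ip.
  + split=> [i|i j ij]; first exact: (corestrict_ip iA _ (fA i) (hphi i)).
    (* The inclusion is injective, so the corestrictions inherit compatibility from the [phi i]. *)
    by apply/funext => x; apply: val_inj; rewrite /= -(cphi i j ij).
  + by [].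
- split=> // [|i]; last by have [Iphi _] := hphi i; exact: ip_range_ideal.
  have iA := directed_bigcup_ip_ideal I_nonempty I_directed _ _ _ mphi
    (fun i => (hphi i).1).
  apply: (range_ideal_incl _ _ _ iA).
  have fA i : range (phi i) `<=` \bigcup_i range (phi i) by move=> u; exists i.
  pose U : normedLatticeType R := ideal_sub iA.
  apply: (direct_limit_surjective _ _ _ _ _ (U : NL_IP R) _
    (fun i => corestrict iA (phi i) (fA i)) (ideal_incl iA) lim).
  + by split; [exact: ideal_incl_ip|exact: ideal_incl_contraction].
  + split=> [i|i j ij].
      have [Iphi nphi] := hphi i; split.
        exact: (corestrict_ip iA _ (fA i) Iphi).
      exact: (corestrict_contraction iA _ (fA i) nphi).
    by apply/funext => x; apply: val_inj; rewrite /= -(cphi i j ij).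
  + by [].
- split=> // [|i]; last first.
    by have [Iphi _] := hphi i; exact: aip_closure_range_ideal.
  (* Almost interval preserving maps give solidity only up to closure, so the ideal is the closure
     of the union. *)
  have iA := directed_bigcup_aip_ideal I_nonempty I_directed _ _ _ mphi
    (fun i => (hphi i).1).
  apply: (range_ideal_incl _ _ _ iA).
  have fA i : range (phi i) `<=` closure (\bigcup_i range (phi i)).
    by move=> u iu; apply: subset_closure; exists i.
  pose U : normedLatticeType R := ideal_sub iA.
  apply: (direct_limit_surjective _ _ _ _ _ (U : NL_AIP R) _
    (fun i => corestrict iA (phi i) (fA i)) (ideal_incl iA) lim).
  + split; last exact: ideal_incl_contraction.
    exact/ip_aip/ideal_incl_ip.
  + split=> [i|i j ij].
      have [Iphi nphi] := hphi i; split.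
        exact: (corestrict_aip iA _ (fA i) Iphi).
      exact: (corestrict_contraction iA _ (fA i) nphi).
    by apply/funext => x; apply: val_inj; rewrite /= -(cphi i j ij).
  + by [].
- split=> // [|i]; last first.
    by have [Iphi _] := hphi i; exact: aip_closure_range_ideal.
  have iA := directed_bigcup_aip_ideal I_nonempty I_directed _ _ _ mphi
    (fun i => (hphi i).1).
  apply: (range_ideal_incl _ _ _ iA).
  have fA i : range (phi i) `<=` closure (\bigcup_i range (phi i)).
    by move=> u iu; apply: subset_closure; exists i.
  (* An ideal that is not closed is not complete, so the Banach lattice structure is built here for
     this closure, not as an instance for every [ideal_sub]. *)
  pose U : banachLatticeType R := HB.pack_for (banachLatticeType R) (ideal_sub iA)
    (Uniform_isComplete.Build _
      (ideal_sub_complete iA (@closed_closure _ (\bigcup_i range (phi i))))).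
  apply: (direct_limit_surjective _ _ _ _ _ (U : BL_AIP R) _
    (fun i => corestrict iA (phi i) (fA i)) (ideal_incl iA) lim).
  + split; last exact: ideal_incl_contraction.
    exact/ip_aip/ideal_incl_ip.
  + split=> [i|i j ij].
      have [Iphi nphi] := hphi i; split.
        exact: (corestrict_aip iA _ (fA i) Iphi).
      exact: (corestrict_contraction iA _ (fA i) nphi).
    by apply/funext => x; apply: val_inj; rewrite /= -(cphi i j ij).
  + by [].
Qed.
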